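(* Let $t$, $d$, $k$, $N$ be positive integers with $k\le d$. If there is a weighted spherical $t$-design in $\mathbb{R}^d$ with $N$ points, then there is a weighted spherical $t$-design in $\mathbb{R}^k$ with at most $2(t+1)N$ points.
   Context: Let $\mu$ be the Lebesgue (surface) measure on the unit sphere $S^{d-1}\subset\mathbb{R}^d$ normalized so that $\mu(S^{d-1})=1$. A weighted spherical $t$-design in $\mathbb{R}^d$ is a finite set $X\subset S^{d-1}$ with a weight function $w\colon X\to\mathbb{R}_{>0}$ such that $\sum_{x\in X}w(x)f(x)=\int_{S^{d-1}}f\,d\mu$ for every polynomial $f$ of total degree at most $t$. *)

(* Defs.v *)
From HB Require Import structures.
From mathcomp Require Import all_boot all_order all_algebra finmap.
(* The notations of mpoly clash with those of mathcomp-analysis. *)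
From mathcomp Require Import -(notations) mpoly.
From mathcomp Require Import all_classical all_reals all_analysis.
From mathcomp Require Import measurable_realfun.

Set Implicit Arguments.
Unset Strict Implicit.
Unset Printing Implicit Defensive.

Import Order.TTheory GRing.Theory Num.Theory.
Import numFieldNormedType.Exports.

Local Open Scope classical_set_scope.
Local Open Scope ring_scope.

(* R^d with its product sigma-algebra, i.e. its Borel sets. *)
Notation Rvec R d := (d.-tuple (measurableTypeR R)).

Section lebesgue_tuple.
Variable R : realType.

Definition vcons n (p : measurableTypeR R * Rvec R n) : Rvec R n.+1 :=
  [tuple of p.1 :: p.2].

Lemma measurable_vcons n : measurable_fun setT (@vcons n).
Proof. exact: measurable_cons. Qed.

Lemma measurable_vcons_pre n (A : set (Rvec R n.+1)) :
  measurable A -> measurable (@vcons n @^-1` A).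
Proof. by move=> mA; rewrite -[X in measurable X]setTI; exact: measurable_vcons. Qed.

Section step.
Local Open Scope ereal_scope.
Variables (n : nat) (m : {sigma_finite_measure set (Rvec R n) -> \bar R}).

Definition lebesgue_vcons : set (Rvec R n.+1) -> \bar R :=
  pushforward (lebesgue_measure \x m) (@vcons n).

Let lebesgue_vcons0 : lebesgue_vcons set0 = 0.
Proof. by rewrite /lebesgue_vcons /pushforward preimage_set0 measure0. Qed.

Let lebesgue_vcons_ge0 A : 0 <= lebesgue_vcons A.
Proof. by rewrite /lebesgue_vcons /pushforward measure_ge0. Qed.

Let lebesgue_vcons_sigma_additive : semi_sigma_additive lebesgue_vcons.
Proof.
move=> F mF tF mUF; rewrite /lebesgue_vcons /pushforward preimage_bigcup.
apply: measure_semi_sigma_additive.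
- by move=> k; exact: measurable_vcons_pre.
- apply/trivIsetP => /= i j _ _ ij; rewrite -preimage_setI.
  by move/trivIsetP : tF => /(_ _ _ _ _ ij) ->//; rewrite preimage_set0.
- by rewrite -preimage_bigcup; exact: measurable_vcons_pre.
Qed.

HB.instance Definition _ := isMeasure.Build _ _ _ lebesgue_vcons
  lebesgue_vcons0 lebesgue_vcons_ge0 lebesgue_vcons_sigma_additive.

Let lebesgue_vcons_sigma_finite : sigma_finite setT lebesgue_vcons.
Proof.
pose g (x : Rvec R n.+1) : measurableTypeR R * Rvec R n := (thead x, [tuple of behead x]).
have gK : cancel (@vcons n) g.
  by case=> x y; rewrite /g /vcons/= theadE; congr pair; apply/val_inj.
have vK : cancel g (@vcons n) by move=> x; rewrite /vcons/= [RHS]tuple_eta.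
have mg : measurable_fun setT g.
  apply/measurable_fun_pair; first exact: measurable_tnth.
  exact: measurable_behead.
have /sigma_finiteP[F [TF ndF Foo]] := sigma_finiteT (@lebesgue_measure R).
have /sigma_finiteP[G [TG ndG Goo]] := sigma_finiteT m.
exists (fun k => g @^-1` (F k `*` G k)).
  apply/esym; rewrite -subTset => x _.
  have [i _ Fi] : (\bigcup_i F i) (g x).1 by rewrite -TF.
  have [j _ Gj] : (\bigcup_i G i) (g x).2 by rewrite -TG.
  exists (maxn i j) => //; split.
    by move: Fi; exact/subsetPset/ndF/leq_maxl.
  by move: Gj; exact/subsetPset/ndG/leq_maxr.
move=> k; have [mF Fk] := Foo k; have [mG Gk] := Goo k.
split; first by rewrite -[X in measurable X]setTI; apply: mg => //; exact: measurableX.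
rewrite /lebesgue_vcons /pushforward -comp_preimage.
rewrite (_ : g \o _ = id); last by apply/funext => x /=; rewrite gK.
by rewrite preimage_id product_measure1E// lte_mul_pinfty// ge0_fin_numE.
Qed.

HB.instance Definition _ := Measure_isSigmaFinite.Build _ _ _ lebesgue_vcons
  lebesgue_vcons_sigma_finite.

End step.

(* Lebesgue measure on R^d, as an iterated product of the one on R. *)
Fixpoint lebesgue_Rvec d : {sigma_finite_measure set (Rvec R d) -> \bar R} :=
  match d with
  | 0 => \d_([tuple] : Rvec R 0)
  | n.+1 => lebesgue_vcons (lebesgue_Rvec n)
  end.

End lebesgue_tuple.

Section box.
Local Open Scope ereal_scope.
Variable R : realType.

Lemma measurable_box d (A : 'I_d -> set (measurableTypeR R)) :
  (forall i, measurable (A i)) ->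
  measurable [set x : Rvec R d | forall i, A i (tnth x i)].
Proof.
move=> mA; rewrite (_ : mkset _ = \bigcap_(i in [set: 'I_d])
    ((fun x : Rvec R d => tnth x i) @^-1` A i)); last first.
  by apply/seteqP; split => x /= H i; [move=> _; exact: H|exact: (H i)].
apply: fin_bigcap_measurable => // i _.
by rewrite -[X in measurable X]setTI; exact: measurable_tnth.
Qed.

(* The property that determines the Lebesgue measure uniquely. *)
Lemma lebesgue_Rvec_box d (A : 'I_d -> set (measurableTypeR R)) :
  (forall i, measurable (A i)) ->
  lebesgue_Rvec R d [set x | forall i, A i (tnth x i)] =
  \prod_(i < d) lebesgue_measure (A i).
Proof.
elim: d A => [|d IH] A mA.
  by rewrite big_ord0 /= /dirac indicE mem_set//= => -[].
have mB : measurable [set x : Rvec R d | forall i, A (lift ord0 i) (tnth x i)].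
  exact: (measurable_box (A := fun i => A (lift ord0 i))).
rewrite big_ord_recl -IH// -product_measure1E//= /lebesgue_vcons /pushforward.
congr (_ _); apply/seteqP; split => [[x y] /= H|[x y] /= [H0 H1] i].
  split; first by have := H ord0.
  by move=> i; have := H (lift ord0 i); rewrite tnthS.
case: (unliftP ord0 i) => [j ->|->//]; rewrite tnthS; exact: H1.
Qed.

End box.

Section sphere.
Variable R : realType.

(* Euclidean norm. *)
Definition enorm d (x : Rvec R d) : R :=
  Num.sqrt (\sum_(i < d) (tnth x i : R) ^+ 2).

Definition unit_sphere d : set (Rvec R d) := [set x | enorm x = 1].

Definition punctured_ball d : set (Rvec R d) := [set x | 0 < enorm x <= 1].

Definition radial_proj d (x : Rvec R d) : Rvec R d :=
  [tuple (tnth x i : R) / enorm x | i < d].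

Lemma measurable_enorm d : measurable_fun [set: Rvec R d] (@enorm d : _ -> R).
Proof.
apply: (measurableT_comp (f := @Num.sqrt R)).
  apply: continuous_measurable_fun.
  exact: sqrt_continuous.
apply: (@measurable_sum _ _ _ _ _ _ (fun i (x : Rvec R d) => (tnth x i : R) ^+ 2)) => i.
apply: (measurableT_comp (f := fun z : R => z ^+ 2)); last exact: measurable_tnth.
exact: exprn_measurable.
Qed.

Lemma measurable_unit_sphere d : measurable (@unit_sphere d).
Proof.
rewrite (_ : @unit_sphere d = setT `&` @enorm d @^-1` [set 1]); last by rewrite setTI.
exact: measurable_enorm.
Qed.

Lemma measurable_punctured_ball d : measurable (@punctured_ball d).
Proof.
rewrite (_ : @punctured_ball d = setT `&` @enorm d @^-1` `]0, 1]%classic).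
  exact: measurable_enorm.
by rewrite setTI; apply/seteqP; split => x /=; rewrite in_itv.
Qed.

Lemma measurable_radial_proj d : measurable_fun setT (@radial_proj d).
Proof.
apply/measurable_fun_tnthP => i.
rewrite (_ : _ \o _ = fun x => (tnth x i : R) * (enorm x)^-1); last first.
  by apply/funext => x /=; rewrite tnth_mktuple.
apply: measurable_funM; first exact: measurable_tnth.
rewrite (_ : (fun _ => _) = (fun z : R => z `^ (-1)) \o @enorm d); last first.
  by apply/funext => x /=; rewrite powR_inv1// sqrtr_ge0.
by apply: measurableT_comp; [exact: measurable_powR|exact: measurable_enorm].
Qed.

End sphere.

Arguments unit_sphere : clear implicits.
Arguments punctured_ball : clear implicits.

Section sphere_measure.
Local Open Scope ereal_scope.
Variables (R : realType) (d : nat).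

(* The measure A |-> vol { r a | a in A, 0 < r <= 1 } on the unit sphere: it is
   1/d times the surface (Hausdorff) measure. The origin is removed from the
   ball because it has no radial projection. *)
Definition cone_measure : set (Rvec R d) -> \bar R :=
  pushforward (mrestr (lebesgue_Rvec R d) (@measurable_punctured_ball R d))
    (@radial_proj R d).

Let mproj (A : set (Rvec R d)) :
  measurable A -> measurable (@radial_proj R d @^-1` A).
Proof.
by move=> mA; rewrite -[X in measurable X]setTI; exact: measurable_radial_proj.
Qed.

Let cone_measure0 : cone_measure set0 = 0.
Proof. by rewrite /cone_measure /pushforward preimage_set0 measure0. Qed.

Let cone_measure_ge0 A : 0 <= cone_measure A.
Proof. by rewrite /cone_measure /pushforward /mrestr measure_ge0. Qed.

Let cone_measure_sigma_additive : semi_sigma_additive cone_measure.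
Proof.
move=> F mF tF mUF; rewrite /cone_measure /pushforward preimage_bigcup.
apply: measure_semi_sigma_additive.
- by move=> k; exact: mproj.
- apply/trivIsetP => /= i j _ _ ij; rewrite -preimage_setI.
  by move/trivIsetP : tF => /(_ _ _ _ _ ij) ->//; rewrite preimage_set0.
- by rewrite -preimage_bigcup; exact: mproj.
Qed.

HB.instance Definition _ := isMeasure.Build _ _ _ cone_measure
  cone_measure0 cone_measure_ge0 cone_measure_sigma_additive.

Lemma cone_measureT : cone_measure setT = lebesgue_Rvec R d (punctured_ball R d).
Proof. by rewrite /cone_measure /pushforward /mrestr preimage_setT setTI. Qed.

Lemma cone_measureT_lty : cone_measure setT < +oo.
Proof.
rewrite cone_measureT.
pose I : set (measurableTypeR R) := `[(-1)%R, 1%R]%classic.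
have mI : measurable I by exact: measurable_itv.
apply: (@le_lt_trans _ _ (lebesgue_Rvec R d [set x | forall i, I (tnth x i)])).
  apply: le_measure; rewrite ?inE.
  - exact: measurable_punctured_ball.
  - exact: (measurable_box (A := fun=> I)).
  - move=> x /= /andP[_ x1] i; rewrite /I/= in_itv/= -ler_norml.
    apply: le_trans x1; rewrite -sqrtr_sqr ler_wsqrtr//.
    by rewrite (bigD1 i)//= lerDl sumr_ge0// => j _; exact: sqr_ge0.
rewrite (lebesgue_Rvec_box (A := fun=> I))//.
rewrite lebesgue_measure_itv/= lte_fin gtrN// -EFinD.
by rewrite -(big_morph _ (@EFinM R) (erefl 1%:E)) ltry.
Qed.

Lemma cone_measureT_gt0 : (0 < d)%N -> 0 < cone_measure setT.
Proof.
move=> d0; rewrite cone_measureT.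
have dR : (0 < d%:R :> R)%R by rewrite ltr0n.
pose I : set (measurableTypeR R) := `]0%R, (d%:R^-1)%R]%classic.
have mI : measurable I by exact: measurable_itv.
apply: (@lt_le_trans _ _ (lebesgue_Rvec R d [set x | forall i, I (tnth x i)])).
  rewrite (lebesgue_Rvec_box (A := fun=> I))//.
  rewrite lebesgue_measure_itv/= lte_fin invr_gt0 dR oppr0 adde0.
  by rewrite -(big_morph _ (@EFinM R) (erefl 1%:E)) lte_fin prodr_gt0// => i _; rewrite invr_gt0.
apply: le_measure; rewrite ?inE.
- exact: (measurable_box (A := fun=> I)).
- exact: measurable_punctured_ball.
move=> x /= xI.
have {}xI i : (0 < (tnth x i : R) <= d%:R^-1)%R by have := xI i; rewrite /I/= in_itv.
apply/andP; split.
  rewrite sqrtr_gt0 (bigD1 (Ordinal d0))//= ltr_pwDl//.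
    by rewrite exprn_gt0//; case/andP: (xI (Ordinal d0)).
  by rewrite sumr_ge0// => j _; exact: sqr_ge0.
rewrite -sqrtr1 ler_wsqrtr//.
apply: (@le_trans _ _ (\sum_(i < d) d%:R^-1)%R); last first.
  by rewrite sumr_const card_ord -(mulr_natl (d%:R^-1 : R)) divff// gt_eqF.
apply: ler_sum => i _; case/andP: (xI i) => x0 x1.
have x11 : ((tnth x i : R) <= 1)%R.
  by rewrite (le_trans x1)// invf_le1// ler1n.
by rewrite expr2 -[leRHS]mulr1; apply: ler_pM => //; exact: ltW.
Qed.

(* Surface measure normalized to total mass 1. By sphere_measureE the default
   value that mnormalize requires is irrelevant as soon as d > 0. *)
Definition sphere_measure : set (Rvec R d) -> \bar R :=
  mnormalize cone_measure \d_([tuple 1%R | i < d] : Rvec R d).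

HB.instance Definition _ := Probability.on sphere_measure.

Lemma sphere_measureE A : (0 < d)%N ->
  sphere_measure A = cone_measure A * (fine (cone_measure setT))^-1%:E.
Proof.
move=> d0; rewrite /sphere_measure /mnormalize.
by rewrite gt_eqF ?cone_measureT_gt0//= lt_eqF ?cone_measureT_lty.
Qed.

End sphere_measure.

Arguments cone_measure : clear implicits.
Arguments sphere_measure : clear implicits.

(* mpoly.msize f is 1 + the total degree of f (and 0 for f = 0). *)
Definition weighted_spherical_design (R : realType) (t d : nat)
    (X : {fset Rvec R d}) (w : X -> R) : Prop :=
  [/\ forall x : X, unit_sphere R d (val x),
      forall x : X, 0 < w x
    & forall f : mpoly.mpoly d R, (mpoly.msize f <= t.+1)%N ->
        (\sum_(x : X) w x * mpoly.meval (tnth (val x)) f)%:E =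
        (\int[sphere_measure R d]_(x in unit_sphere R d)
           (mpoly.meval (tnth x) f)%:E)%E].

Arguments weighted_spherical_design {R} t {d} X w.

(* Main.v *)
Require Import Defs.
From HB Require Import structures.
From mathcomp Require Import all_boot all_order all_algebra finmap.
From mathcomp Require Import -(notations) mpoly.
From mathcomp Require Import all_classical all_reals all_analysis.
From mathcomp Require Import measurable_realfun.
From mathcomp Require Import ring lra zify.

(** A spherical design in [R^d] is pushed to [R^k] by a coordinate projection
    [P], followed by radial projection to the unit sphere. The bound obtained is
    [2 * N] points.

    The projection [P] maps the normalized surface measure of [S^(d-1)] to a
    rotation invariant measure on the unit ball of [R^k]. Such a measure is, in
    polar coordinates, a product of a radial measure and of the surface measure
    of [S^(k-1)]; hence for every [g] that is homogeneous of degree [e] the mean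
    of [g (P x)] over [S^(d-1)] is [c] times the mean of [g] over [S^(k-1)],
    where [c > 0] depends on [e] only ([integral_sphere_measure_projection]).
    This is proved one dropped coordinate at a time by Tonelli's theorem
    ([integral_cone_measure_drop1]), from the independence of direction and
    length in the ball ([integral_ball_measure_polar]), which itself comes from
    the homogeneity of volume ([lebesgue_Rvec_dilation]).

    Let [e] be the largest even number with [e <= t]. If all monomials of [f]
    have even degree at most [t], then multiplying each by a power of the
    squared norm yields a homogeneous polynomial of degree [e] with the same
    values on the sphere. A design [(X, w)] of strength [t] integrates its
    pullback along [P] exactly, and by homogeneity the weight [w x] at [P x]
    acts as the weight [w x * |P x| ^ e] at [P x / |P x|], points with [P x = 0]
    contributing nothing as soon as [e > 0]. So these directions, with weights
    divided by [c], integrate even polynomials of degree at most [t]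
    ([projected_design]). Adding the antipodes with half weights makes the sum
    vanish on odd monomials, as the integral does by the reflection symmetry of
    the surface measure ([antipodal_design_of_family]).

    For [t = 1] the degree [e] is 0 and all the [P x] may vanish, but then any
    antipodal pair is a design. *)

Set Implicit Arguments.
Unset Strict Implicit.
Unset Printing Implicit Defensive.

Import Order.TTheory GRing.Theory Num.Theory.
Import numFieldNormedType.Exports.

Local Open Scope classical_set_scope.
Local Open Scope ring_scope.

(** * Dilations of Lebesgue measure *)

Section dilation.
Variable R : realType.
Local Open Scope ereal_scope.

Definition vscale d (a : R) (x : Rvec R d) : Rvec R d :=
  [tuple (a * tnth x i)%R | i < d].

Lemma tnth_vscale d (a : R) (x : Rvec R d) i :
  tnth (vscale a x) i = (a * tnth x i)%R.
Proof. by rewrite tnth_mktuple. Qed.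

Lemma measurable_vscale d (a : R) : measurable_fun setT (@vscale d a).
Proof.
apply/measurable_fun_tnthP => i.
rewrite (_ : _ \o _ = fun x : Rvec R d => (a * tnth x i)%R); last first.
  by apply/funext => x /=; rewrite tnth_mktuple.
by apply: measurable_funM; [exact: measurable_cst|exact: measurable_tnth].
Qed.

Let measurable_scale1 (a : R) :
  measurable_fun [set: measurableTypeR R]
    (fun x : measurableTypeR R => (a * x)%R : measurableTypeR R).
Proof. by apply: measurable_funM; [exact: measurable_cst|exact: measurable_id]. Qed.

Lemma lebesgue_measure_dilation (a : R) (A : set (measurableTypeR R)) :
  a != 0%R -> measurable A ->
  lebesgue_measure A =
  `|a|%:E * lebesgue_measure
    ((fun x : measurableTypeR R => (a * x)%R : measurableTypeR R) @^-1` A).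
Proof.
move=> a0 mA.
pose m : {measure set (measurableTypeR R) -> \bar R} :=
  mscale (NngNum (normr_ge0 a))
    (measure_function_pushforward__canonical__measure_function_Measure
       (@lebesgue_measure R) (measurable_scale1 a)).
have -> // : lebesgue_measure A = m A.
apply: lebesgue_measure_unique => // _ [[b c] _ <-] /=.
rewrite /m/= /mscale/= /pushforward.
have [a_gt0|a_lt0|a_eq0] := ltgtP 0%R a; last by rewrite -a_eq0 eqxx in a0.
- rewrite (_ : _ @^-1` _ = `](b / a)%R, (c / a)%R]%classic); last first.
    apply/seteqP; split => x /=; rewrite !in_itv/= ltr_pdivrMr// ler_pdivlMr//;
    by rewrite mulrC.
  rewrite !lebesgue_measure_itv/= !lte_fin ltr_pM2r ?invr_gt0// gtr0_norm//.
  case: ifPn => bc; last by rewrite mule0.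
  by rewrite -!EFinD -EFinM; congr EFin; field.
- rewrite (_ : _ @^-1` _ = `[(c / a)%R, (b / a)%R[%classic); last first.
    apply/seteqP; split => x /=; rewrite !in_itv/= ltr_ndivlMr// ler_ndivrMr//;
    by rewrite mulrC andbC.
  rewrite !lebesgue_measure_itv/= !lte_fin ltr_nM2r ?invr_lt0// ltr0_norm//.
  case: ifPn => bc; last by rewrite mule0.
  by rewrite -!EFinD -EFinM; congr EFin; field.
Qed.

(** Both sides are measures on a product that agree on rectangles. The case
    [a = -1] is the reflection symmetry of volume. *)
Lemma lebesgue_Rvec_dilation d (a : R) (A : set (Rvec R d)) :
  a != 0%R -> measurable A ->
  lebesgue_Rvec R d A = (`|a| ^+ d)%:E * lebesgue_Rvec R d (vscale a @^-1` A).
Proof.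
move=> a0; elim: d A => [|d IH] A mA.
  rewrite expr0 mul1e (_ : _ @^-1` _ = A)//.
  by apply/seteqP; split => x /=; rewrite (tuple0 x) (tuple0 (vscale _ _)).
pose s (p : measurableTypeR R * Rvec R d) : measurableTypeR R * Rvec R d :=
  ((a * p.1)%R, vscale a p.2).
have ms : measurable_fun setT s.
  apply/measurable_fun_pair.
    exact: (measurableT_comp (measurable_scale1 a) measurable_fst).
  exact: (measurableT_comp (measurable_vscale a) measurable_snd).
pose m : {measure set (measurableTypeR R * Rvec R d) -> \bar R} :=
  mscale (NngNum (exprn_ge0 d.+1 (normr_ge0 a)))
    (measure_function_pushforward__canonical__measure_function_Measure
       (lebesgue_measure \x lebesgue_Rvec R d) ms).
have mE B : measurable B -> (lebesgue_measure \x lebesgue_Rvec R d) B = m B.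
  apply: product_measure_unique => {mA A}A {}B mA mB.
  rewrite /m/= /mscale/= /pushforward.
  transitivity ((`|a| ^+ d.+1)%:E * (lebesgue_measure \x lebesgue_Rvec R d)
     (((fun x : measurableTypeR R => (a * x)%R : measurableTypeR R) @^-1` A)
         `*` (vscale a @^-1` B))) => //.
  rewrite product_measure1E.
  - rewrite (lebesgue_measure_dilation a0 mA) (IH _ mB) exprS EFinM.
    by rewrite muleACA.
  - by rewrite -[X in measurable X]setTI; exact: measurable_scale1.
  - by rewrite -[X in measurable X]setTI; exact: measurable_vscale.
rewrite /= /lebesgue_vcons /pushforward mE; last exact: measurable_vcons_pre.
rewrite /m/= /mscale/= /pushforward; congr (_ * _); congr (_ _).
rewrite -comp_preimage -[RHS]comp_preimage.
rewrite (_ : @vcons R d \o s = vscale a \o @vcons R d)//.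
apply/funext => -[x y] /=; apply: eq_from_tnth => i; rewrite tnth_vscale.
case: (unliftP ord0 i) => [j ->|->]; last by rewrite !tnth0.
by rewrite !tnthS tnth_vscale.
Qed.

End dilation.

(** * Polar coordinates in the unit ball *)

Section finite_measures_on_the_line.
Variable R : realType.
Local Open Scope ereal_scope.

(** The closed left rays form a pi-system whose complements generate the Borel
    sets; finiteness is what lets equality pass to complements. *)
Lemma finite_measure_unique_rays
    (m1 m2 : {measure set (measurableTypeR R) -> \bar R}) :
  m1 setT < +oo -> m1 setT = m2 setT ->
  (forall s : R, m1 `]-oo, s]%classic = m2 `]-oo, s]%classic) ->
  forall B, measurable B -> m1 B = m2 B.
Proof.
move=> m1T m12T m12 B mB.
have fin1 (A : set (measurableTypeR R)) : measurable A -> m1 A < +oo.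
  by move=> mA; apply: le_lt_trans m1T; apply: le_measure; rewrite ?inE.
apply: (@measure_unique _ R (measurableTypeR R) (@RGenOInfty.G R)
  (fun n => `](- n%:R)%R, +oo[%classic) _ _ _ _ m1 m2) => //.
- exact: RGenOInfty.measurableE.
- move=> _ _ [x ->] [y ->]; exists (Num.max x y).
  by apply/seteqP; split => z /=; rewrite !in_itv/= !andbT gt_max => /andP.
- by move=> n; exists (- n%:R)%R.
- rewrite -subTset => x _; exists (Num.truncn `|x|).+1 => //=.
  rewrite in_itv/= andbT ltrNl (le_lt_trans (ler_norm _))// normrN.
  by rewrite truncnS_gt.
- move=> _ [s ->].
  rewrite -setCitvl -setTD !measureD//.
  + by rewrite !setTI; congr (_ - _); [exact: m12T|exact: m12].
  + by move: m1T; rewrite m12T.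
- by move=> n; apply: fin1.
Qed.

End finite_measures_on_the_line.

Section polar_coordinates.
Variable R : realType.
Local Open Scope ereal_scope.

Lemma enorm_ge0 d (x : Rvec R d) : (0 <= enorm x)%R.
Proof. exact: sqrtr_ge0. Qed.

Lemma sqr_enorm d (x : Rvec R d) : (enorm x ^+ 2 = \sum_(i < d) tnth x i ^+ 2)%R.
Proof. by rewrite sqr_sqrtr// sumr_ge0// => i _; exact: sqr_ge0. Qed.

Lemma tnth_radial_proj d (x : Rvec R d) i :
  tnth (radial_proj x) i = (tnth x i / enorm x)%R.
Proof. by rewrite tnth_mktuple. Qed.

Lemma enorm_vscale d (a : R) (x : Rvec R d) :
  enorm (vscale a x) = (`|a| * enorm x)%R.
Proof.
rewrite /enorm -sqrtr_sqr -sqrtrM ?sqr_ge0// mulr_sumr.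
by congr Num.sqrt; apply: eq_bigr => i _; rewrite tnth_vscale exprMn.
Qed.

Lemma radial_projE d (x : Rvec R d) : radial_proj x = vscale (enorm x)^-1 x.
Proof. by apply: eq_from_tnth => i; rewrite tnth_radial_proj tnth_vscale mulrC. Qed.

Lemma enorm_radial_proj d (x : Rvec R d) :
  (0 < enorm x)%R -> enorm (radial_proj x) = 1%R.
Proof.
by move=> x0; rewrite radial_projE enorm_vscale ger0_norm ?invr_ge0 ?ltW// mulVf ?gt_eqF.
Qed.

Lemma radial_proj_vscale d (a : R) (x : Rvec R d) : (0 < a)%R ->
  radial_proj (vscale a x) = radial_proj x.
Proof.
move=> a0; apply: eq_from_tnth => i.
by rewrite !tnth_radial_proj tnth_vscale enorm_vscale gtr0_norm// -mulf_div divff ?mul1r ?gt_eqF.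
Qed.

Variable d : nat.

Local Notation vol := (lebesgue_Rvec R d).

(** By definition [cone_measure] is the law of the direction under this measure;
    [radial_measure] is the law of the length. *)
Definition ball_measure : set (Rvec R d) -> \bar R :=
  mrestr vol (@measurable_punctured_ball R d).

HB.instance Definition _ := Measure.on ball_measure.

Lemma ball_measureT : ball_measure setT = cone_measure R d setT.
Proof. by rewrite cone_measureT /ball_measure /mrestr setTI. Qed.

Let measurable_enorm' :
  measurable_fun [set: Rvec R d] (@enorm R d : _ -> measurableTypeR R).
Proof. exact: measurable_enorm. Qed.

Definition radial_measure : set (measurableTypeR R) -> \bar R :=
  pushforward ball_measure (@enorm R d : _ -> measurableTypeR R).

HB.instance Definition _ := Measure.copy radial_measure
  (measure_function_pushforward__canonical__measure_function_Measure
     ball_measure measurable_enorm').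

Let radial_measure_fin : fin_num_fun radial_measure.
Proof.
apply: lty_fin_num_fun.
by have := @cone_measureT_lty R d; rewrite -ball_measureT.
Qed.

HB.instance Definition _ :=
  Measure_isFinite.Build _ _ _ radial_measure radial_measure_fin.

Let cone_measure_fin : fin_num_fun (cone_measure R d).
Proof. by apply: lty_fin_num_fun; exact: cone_measureT_lty. Qed.

HB.instance Definition _ :=
  Measure_isFinite.Build _ _ _ (cone_measure R d) cone_measure_fin.

Lemma measurable_cone_sector A (B : set (measurableTypeR R)) :
  measurable A -> measurable B ->
  measurable (@radial_proj R d @^-1` A `&` @enorm R d @^-1` B).
Proof.
move=> mA mB; apply: measurableI.
  by rewrite -[X in measurable X]setTI; exact: measurable_radial_proj.
by rewrite -[X in measurable X]setTI; exact: measurable_enorm'.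
Qed.

(** Radii above 1 and below 0 are clamped because [ball_measure] only sees the
    punctured unit ball; in between this is the homogeneity of volume. *)
Lemma ball_measure_cone_ray A (s : R) : (0 < d)%N -> measurable A ->
  ball_measure (@radial_proj R d @^-1` A `&` @enorm R d @^-1` `]-oo, s]%classic) =
  (Num.max 0 (Num.min s 1) ^+ d)%:E * cone_measure R d A.
Proof.
move=> d0 mA; rewrite /ball_measure /cone_measure /pushforward /mrestr.
have [s0|s0] := lerP s 0%R.
  rewrite (_ : Num.max _ _ = 0%R); last by rewrite min_l ?max_l// (le_trans s0).
  rewrite expr0n gtn_eqF// mul0e (_ : _ `&` _ `&` _ = set0) ?measure0//.
  apply/seteqP; split => x //= -[[_]]; rewrite in_itv/= => xs /andP[x0 _].
  by have := lt_le_trans x0 (le_trans xs s0); rewrite ltxx.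
have [s1|s1] := leP s 1%R; last first.
  rewrite max_r ?ler01// expr1n mul1e; congr (vol _).
  apply/seteqP; split => x /=; first by move=> [[]].
  move=> [Ax /andP[x0 x1]]; split; last by rewrite /punctured_ball/= x0.
  by split => //; rewrite in_itv/= (le_trans x1)// ltW.
rewrite max_r ?ltW//.
rewrite (lebesgue_Rvec_dilation (lt0r_neq0 s0)).
  rewrite gtr0_norm//; congr (_ * vol _).
  apply/seteqP; split => x; rewrite /preimage/punctured_ball/= in_itv/= radial_proj_vscale// enorm_vscale;
    rewrite gtr0_norm// pmulr_rgt0//.
    move=> [[Ax xs] /andP[-> _]]; split => //=.
    by move: xs; rewrite -ler_pdivlMl// mulVf ?gt_eqF.
  move=> [Ax /andP[-> x1]]; split => //.
    by split=> //; rewrite ler_piMr// ltW.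
  by rewrite andTb mulr_ile1 ?enorm_ge0// ltW.
apply: measurableI; last exact: measurable_punctured_ball.
exact: measurable_cone_sector.
Qed.

(** Direction and length are independent under [ball_measure]: on rays of radii
    both sides are the same power of the radius times the same constant, and
    rays determine a finite measure. *)
Lemma ball_measure_cone_sector A (B : set (measurableTypeR R)) :
  (0 < d)%N -> measurable A -> measurable B ->
  cone_measure R d setT *
    ball_measure (@radial_proj R d @^-1` A `&` @enorm R d @^-1` B) =
  cone_measure R d A * radial_measure B.
Proof.
move=> d0 mA; move: B.
have mpA : measurable (@radial_proj R d @^-1` A).
  by rewrite -[X in measurable X]setTI; exact: measurable_radial_proj.
have fV : cone_measure R d setT \is a fin_num by exact: fin_num_measure.
have fA : cone_measure R d A \is a fin_num by exact: fin_num_measure.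
pose m1 : {measure set (measurableTypeR R) -> \bar R} :=
  mscale (NngNum (fine_ge0 (measure_ge0 (cone_measure R d) setT)))
  (measure_function_pushforward__canonical__measure_function_Measure
     (mrestr ball_measure mpA) measurable_enorm').
pose m2 : {measure set (measurableTypeR R) -> \bar R} :=
  mscale (NngNum (fine_ge0 (measure_ge0 (cone_measure R d) A))) radial_measure.
have m1E B : m1 B = cone_measure R d setT *
    ball_measure (@radial_proj R d @^-1` A `&` @enorm R d @^-1` B).
  by rewrite /m1/= /mscale/= fineK// /pushforward /mrestr/= setIC.
have m2E B : m2 B = cone_measure R d A * radial_measure B.
  by rewrite /m2/= /mscale/= fineK.
move=> B mB; rewrite -m1E -m2E.
have m12T : m1 setT = m2 setT.
  rewrite m1E m2E /radial_measure /pushforward !preimage_setT ball_measureT.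
  by rewrite setIT muleC.
apply: finite_measure_unique_rays => //.
  have fR : radial_measure setT \is a fin_num by exact: fin_num_measure.
  by rewrite m12T m2E ltey_eq fin_numM.
move=> s; rewrite m1E m2E ball_measure_cone_ray//.
rewrite /radial_measure /pushforward.
have := @ball_measure_cone_ray setT s d0 measurableT.
by rewrite preimage_setT setTI => ->; rewrite muleCA [RHS]muleCA [in RHS](muleC (cone_measure R d A)).
Qed.

Let polar (x : Rvec R d) : Rvec R d * measurableTypeR R := (radial_proj x, enorm x).

Let measurable_polar : measurable_fun setT polar.
Proof.
by apply/measurable_fun_pair; [exact: measurable_radial_proj|exact: measurable_enorm'].
Qed.

(** Independence makes the joint law of direction and length a product measure,
    to which Tonelli's theorem applies. *)
Lemma integral_ball_measure_polar (h : Rvec R d -> \bar R)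
    (psi : measurableTypeR R -> \bar R) : (0 < d)%N ->
  measurable_fun setT h -> measurable_fun setT psi ->
  (forall x, 0 <= h x) -> (forall r, 0 <= psi r) ->
  cone_measure R d setT *
    \int[ball_measure]_x (h (radial_proj x) * psi (enorm x)) =
  \int[cone_measure R d]_x h x * \int[radial_measure]_r psi r.
Proof.
move=> d0 mh mpsi h0 psi0.
have fV : cone_measure R d setT \is a fin_num by exact: fin_num_measure.
pose f (p : Rvec R d * measurableTypeR R) := h p.1 * psi p.2.
have mf : measurable_fun setT f.
  apply: emeasurable_funM.
    exact: (measurableT_comp mh measurable_fst).
  exact: (measurableT_comp mpsi measurable_snd).
have f0 p : 0 <= f p by rewrite mule_ge0.
pose m : {measure set (Rvec R d * measurableTypeR R) -> \bar R} :=
  mscale (NngNum (fine_ge0 (measure_ge0 (cone_measure R d) setT)))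
  (measure_function_pushforward__canonical__measure_function_Measure
     ball_measure measurable_polar).
have mE X : measurable X -> (cone_measure R d \x radial_measure) X = m X.
  apply: product_measure_unique => A B mA mB.
  rewrite -ball_measure_cone_sector// /m/= /mscale/= fineK//.
transitivity (\int[m]_p f p).
  rewrite /m ge0_integral_mscale//= fineK//; congr (_ * _).
  by rewrite ge0_integral_pushforward// => p _.
transitivity (\int[cone_measure R d \x radial_measure]_p f p).
  by apply: eq_measure_integral => A mA _; rewrite -mE.
rewrite fubini_tonelli1// /fubini_F /f/=.
under eq_integral => x _ do rewrite ge0_integralZl//.
rewrite ge0_integralZr//.
exact: integral_ge0.
Qed.

End polar_coordinates.

(** * Integrals of homogeneous functions over the sphere *)

Section homogeneous_integrals.
Variable R : realType.
Local Open Scope ereal_scope.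

Definition vproj k d (phi : 'I_k -> 'I_d) (x : Rvec R d) : Rvec R k :=
  [tuple tnth x (phi i) | i < k].

Lemma tnth_vproj k d (phi : 'I_k -> 'I_d) (x : Rvec R d) i :
  tnth (vproj phi x) i = tnth x (phi i).
Proof. by rewrite tnth_mktuple. Qed.

Lemma measurable_vproj k d (phi : 'I_k -> 'I_d) : measurable_fun setT (vproj phi).
Proof.
apply/measurable_fun_tnthP => i.
rewrite (_ : _ \o _ = fun x : Rvec R d => tnth x (phi i)); last first.
  by apply/funext => x /=; rewrite tnth_mktuple.
exact: measurable_tnth.
Qed.

Lemma vproj_id d (x : Rvec R d) : vproj id x = x.
Proof. by apply: eq_from_tnth => i; rewrite tnth_vproj. Qed.

Lemma vproj_vscale k d (phi : 'I_k -> 'I_d) a (x : Rvec R d) :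
  vproj phi (vscale a x) = vscale a (vproj phi x).
Proof. by apply: eq_from_tnth => i; rewrite !(tnth_vproj, tnth_vscale). Qed.

Lemma vproj_vcons d (p : measurableTypeR R * Rvec R d) :
  vproj (lift ord0) (vcons p) = p.2.
Proof. by apply: eq_from_tnth => i; rewrite tnth_vproj tnthS. Qed.

Lemma enorm_vcons d (p : measurableTypeR R * Rvec R d) :
  enorm (vcons p) = Num.sqrt ((p.1 : R) ^+ 2 + enorm p.2 ^+ 2)%R.
Proof.
rewrite sqr_enorm /enorm big_ord_recl tnth0; congr (Num.sqrt (_ + _)).
by apply: eq_bigr => i _; rewrite tnthS.
Qed.

(** This also holds at the origin, where both sides are the origin. *)
Lemma vscale_radial_proj d (x : Rvec R d) : vscale (enorm x) (radial_proj x) = x.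
Proof.
apply: eq_from_tnth => i; rewrite tnth_vscale tnth_radial_proj mulrC.
have [x0|x0] := eqVneq (enorm x) 0%R; last by rewrite divfK.
rewrite x0 mulr0; move: (sqr_enorm x); rewrite x0 expr0n /= => /esym/eqP.
rewrite psumr_eq0; last by move=> j _; exact: sqr_ge0.
by move=> /allP/(_ i (mem_index_enum _)); rewrite implyTb sqrf_eq0 => /eqP ->.
Qed.

Definition homogeneous d e (g : Rvec R d -> R) :=
  forall a x, (0 <= a)%R -> g (vscale a x) = (a ^+ e * g x)%R.

Lemma homogeneous_vproj k d (phi : 'I_k -> 'I_d) e g :
  homogeneous e g -> homogeneous e (g \o vproj phi).
Proof. by move=> hg a x a0 /=; rewrite vproj_vscale hg. Qed.

Lemma homogeneousE d e (g : Rvec R d -> R) x : homogeneous e g ->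
  g x = (enorm x ^+ e * g (radial_proj x))%R.
Proof. by move=> hg; rewrite -{1}(vscale_radial_proj x) hg// enorm_ge0. Qed.

Lemma homogeneous_enorm d e : homogeneous e (fun x : Rvec R d => enorm x ^+ e)%R.
Proof. by move=> a x a0; rewrite enorm_vscale ger0_norm// exprMn. Qed.

Lemma ge0_integral_mrestr dp (T : measurableType dp)
    (mu : {measure set T -> \bar R}) D (mD : measurable D) (f : T -> \bar R) :
  measurable_fun setT f -> (forall x, 0 <= f x) ->
  \int[mrestr mu mD]_x f x = \int[mu]_(x in D) f x.
Proof.
move=> mf f0.
rewrite (@ge0_negligible_integral _ _ _ (mrestr mu mD) setT (~` D))//.
- rewrite setTD setCK; apply: eq_measure_integral => A mA AD.
  by congr (mu _); rewrite setIidl.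
- exact: measurableC.
- by rewrite /= /mrestr setICl measure0.
Qed.

Lemma ge0_integral_cone_measure d (f : Rvec R d -> \bar R) :
  measurable_fun setT f -> (forall x, 0 <= f x) ->
  \int[cone_measure R d]_x f x = \int[@ball_measure R d]_x f (radial_proj x).
Proof.
move=> mf f0.
by rewrite (ge0_integral_pushforward (@measurable_radial_proj R d) (@ball_measure R d)).
Qed.

(** The factor [r ^- e] that undoes a homogeneity of degree [e], restricted to
    the radii of the punctured unit ball; a real power makes it measurable on
    the whole line. *)
Let cutoff e (r : R) : R := (powR r (- e%:R) * \1_(`]0, 1]%classic) r)%R.

Let cutoff_ge0 e r : (0 <= cutoff e r)%R.
Proof. by rewrite mulr_ge0// ?powR_ge0//. Qed.

Let measurable_cutoff e : measurable_fun setT (cutoff e).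
Proof.
apply: measurable_funM; first exact: measurable_powR.
exact: measurable_indic.
Qed.

Let cutoffE e r : (0 < r <= 1)%R -> cutoff e r = (r ^+ e)^-1%R.
Proof.
move=> /andP[r0 r1]; rewrite /cutoff powRN powR_mulrn ?ltW// indicE mem_set ?mulr1//.
by rewrite /= in_itv/= r0.
Qed.

Let cutoff0 e r : ~~ (0 < r <= 1)%R -> cutoff e r = 0%R.
Proof.
move=> r1; rewrite /cutoff indicE memNset ?mulr0//=.
by rewrite in_itv/=; exact/negP.
Qed.

Let measurable_hypot : measurable_fun setT
  (fun p : measurableTypeR R * measurableTypeR R =>
     Num.sqrt ((p.1 : R) ^+ 2 + (p.2 : R) ^+ 2)%R : R).
Proof.
apply: (measurableT_comp (f := @Num.sqrt R)).
  by apply: continuous_measurable_fun; exact: sqrt_continuous.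
apply: measurable_funD.
  by apply: measurable_funX; exact: measurable_fst.
by apply: measurable_funX; exact: measurable_snd.
Qed.

(** Dropping one coordinate: in the unit ball of dimension [d.+1], integrating
    first over the dropped coordinate leaves a radial weight on the remaining
    [d] coordinates, and polar coordinates separate that weight from [g]. *)
Lemma integral_cone_measure_drop1 d e : (0 < d)%N -> (0 < e)%N ->
  exists2 C : \bar R, 0 <= C & forall g : Rvec R d -> R,
    measurable_fun setT g -> (forall x, (0 <= g x)%R) -> homogeneous e g ->
    \int[cone_measure R d.+1]_x (g (vproj (lift ord0) x))%:E =
    C * \int[cone_measure R d]_y (g y)%:E.
Proof.
move=> d0 e0.
have V_gt0 := cone_measureT_gt0 R d0; have V_lty := @cone_measureT_lty R d.
set V := cone_measure R d setT in V_gt0 V_lty.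
have fV : V \is a fin_num by rewrite ge0_fin_numE// ltW.
pose k (p : measurableTypeR R * measurableTypeR R) :=
  (cutoff e (Num.sqrt ((p.1 : R) ^+ 2 + (p.2 : R) ^+ 2)%R))%:E.
have k0 p : 0 <= k p by rewrite lee_fin.
have mk : measurable_fun setT k.
  apply/measurable_EFinP.
  exact: (measurableT_comp (measurable_cutoff e) measurable_hypot).
pose Psi (r : measurableTypeR R) := \int[lebesgue_measure]_s k (s, r).
have Psi0 r : 0 <= Psi r by apply: integral_ge0.
have mPsi : measurable_fun setT Psi.
  exact: (measurable_fun_fubini_tonelli_G (m1 := lebesgue_measure) k).
(* Radii are nonnegative; the maximum keeps [psi] nonnegative on the line. *)
pose psi (r : measurableTypeR R) := ((Num.max r 0%R : R) ^+ e)%:E * Psi r.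
have mpsi : measurable_fun setT psi.
  apply: emeasurable_funM => //; apply/measurable_EFinP/measurable_funX.
  by apply: measurable_maxr; [exact: measurable_id|exact: measurable_cst].
have psi0 r : 0 <= psi r.
  by rewrite mule_ge0// lee_fin exprn_ge0// le_max lexx orbT.
exists ((fine V)^-1%:E * \int[@radial_measure R d]_r psi r).
  apply: mule_ge0; last exact: integral_ge0.
  by rewrite lee_fin invr_ge0 fine_ge0// ltW.
move=> g mg g0 hg.
have mgE : measurable_fun setT (EFin \o g) by exact/measurable_EFinP.
have gP0 (x : Rvec R d.+1) : 0 <= (g (vproj (lift ord0) x))%:E by rewrite lee_fin.
have mgP : measurable_fun setT (fun x : Rvec R d.+1 => (g (vproj (lift ord0) x))%:E).
  by apply/measurable_EFinP; exact: (measurableT_comp mg (@measurable_vproj _ _ _)).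
rewrite ge0_integral_cone_measure//.
rewrite /ball_measure ge0_integral_mrestr//; last first.
  exact: (measurableT_comp mgP (@measurable_radial_proj R _)).
rewrite integral_mkcond.
transitivity (\int[lebesgue_Rvec R d.+1]_x
    ((cutoff e (enorm x))%:E * (g (vproj (lift ord0) x))%:E)).
  apply: eq_integral => x _; rewrite patchE; case: ifPn => [/set_mem x1|/negP x1].
    have := homogeneousE x (@homogeneous_vproj d d.+1 (lift ord0) e g hg).
    move=> /= ->; rewrite cutoffE// -EFinM mulKf// expf_neq0//.
    by case/andP: x1 => x0 _; rewrite gt_eqF.
  rewrite cutoff0 ?mul0e//; apply/negP => x1'; apply: x1; exact/mem_set.
have mI : measurable_fun setT (fun x : Rvec R d.+1 =>
    (cutoff e (enorm x))%:E * (g (vproj (lift ord0) x))%:E).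
  apply: emeasurable_funM => //; apply/measurable_EFinP.
  exact: (measurableT_comp (measurable_cutoff e) (@measurable_enorm R _)).
have I0 (x : Rvec R d.+1) :
    0 <= (cutoff e (enorm x))%:E * (g (vproj (lift ord0) x))%:E.
  by rewrite mule_ge0// lee_fin.
rewrite /= /lebesgue_vcons.
rewrite (ge0_integral_pushforward (@measurable_vcons R d) (lebesgue_measure \x lebesgue_Rvec R d))//.
rewrite preimage_setT fubini_tonelli2//=; last exact: (measurableT_comp mI (@measurable_vcons R d)).
transitivity (\int[lebesgue_Rvec R d]_y (Psi (enorm y) * (g y)%:E)).
  apply: eq_integral => y _; rewrite /fubini_G /=.
  transitivity (\int[lebesgue_measure]_s (k (s, enorm y) * (g y)%:E)).
    by apply: eq_integral => s _; rewrite enorm_vcons vproj_vcons.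
  rewrite ge0_integralZr//.
  - by apply: (measurableT_comp mk); exact: measurable_pair2.
  - by rewrite lee_fin.
have mgproj : measurable_fun setT (fun x : Rvec R d => (g (radial_proj x))%:E).
  exact: (measurableT_comp mgE (@measurable_radial_proj R d)).
have mpsin : measurable_fun setT (fun x : Rvec R d => psi (enorm x)).
  exact: (measurableT_comp mpsi (@measurable_enorm R d)).
transitivity (\int[@ball_measure R d]_y ((g (radial_proj y))%:E * psi (enorm y))).
  rewrite /ball_measure ge0_integral_mrestr//; last 2 first.
  - exact: emeasurable_funM.
  - by move=> y; rewrite mule_ge0// lee_fin.
  rewrite [RHS]integral_mkcond; apply: eq_integral => y _; rewrite patchE.
  case: ifPn => [_|/negP y1].
    rewrite (homogeneousE y hg) EFinM /psi max_l ?enorm_ge0//.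
    by rewrite muleC muleAC [RHS]muleC.
  (* Off the punctured ball: at the origin [g] vanishes, and outside the
     closed ball every point with this radius is cut off. *)
  have [y0|y0] := eqVneq (enorm y) 0%R.
    by rewrite (homogeneousE y hg) y0 expr0n gtn_eqF// mul0r mule0.
  have y_gt1 : (1 < enorm y)%R.
    rewrite ltNge; apply/negP => yle1; apply: y1; apply/mem_set.
    by rewrite /punctured_ball/= yle1 lt_neqAle eq_sym y0 enorm_ge0.
  rewrite /Psi integral0_eq ?mul0e// => s _; rewrite /k/= cutoff0//.
  rewrite negb_and -leNgt -ltNge; apply/orP; right.
  rewrite -sqrtr1 ltr_sqrt; last by rewrite ltr_wpDl ?sqr_ge0// exprn_gt0// (lt_trans ltr01).
  by rewrite ltr_wpDl ?sqr_ge0// exprn_egt1.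
have := integral_ball_measure_polar d0 mgE mpsi g0 psi0.
rewrite -/V => polar.
rewrite -muleA (muleC (\int[_]_r psi r)) -polar muleA.
by rewrite -{2}(fineK fV) -EFinM mulVf ?mul1e// gt_eqF// fine_gt0// V_gt0.
Qed.
End homogeneous_integrals.

(** * Projection of the sphere measure *)

Section projection_of_the_sphere.
Variable R : realType.
Local Open Scope ereal_scope.

Lemma integral_cone_measure_drop j k e : (0 < k)%N -> (0 < e)%N ->
  exists2 C : \bar R, 0 <= C & forall g : Rvec R k -> R,
    measurable_fun setT g -> (forall x, (0 <= g x)%R) -> homogeneous e g ->
    \int[cone_measure R (j + k)]_x (g (vproj (@rshift j k) x))%:E =
    C * \int[cone_measure R k]_y (g y)%:E.
Proof.
move=> k0 e0; elim: j => [|j [C C0 IH]].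
  exists 1 => // g _ _ _; rewrite mul1e; apply: eq_integral => x _.
  congr (g _)%:E; apply: eq_from_tnth => i; rewrite tnth_vproj.
  by congr tnth; exact: val_inj.
have jk0 : (0 < j + k)%N by rewrite addn_gt0 k0 orbT.
have [C' C'0 step] := @integral_cone_measure_drop1 R (j + k) e jk0 e0.
exists (C' * C); first exact: mule_ge0.
move=> g mg g0 hg; rewrite -muleA -IH//.
rewrite -(step (g \o vproj (@rshift j k))).
- apply: eq_integral => x _; congr (g _)%:E; apply: eq_from_tnth => i.
  by rewrite !tnth_vproj; congr tnth; exact: val_inj.
- exact: (measurableT_comp mg (@measurable_vproj _ _ _ _)).
- by move=> x; exact: g0.
- exact: homogeneous_vproj.
Qed.

Lemma sphere_measure_unit_sphereC d : (0 < d)%N ->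
  sphere_measure R d (~` unit_sphere R d) = 0.
Proof.
move=> d0; rewrite sphere_measureE// /cone_measure /pushforward /mrestr.
rewrite (_ : _ `&` _ = set0) ?measure0 ?mul0e//.
apply/seteqP; split => x //= -[xS /andP[x0 _]]; apply: xS.
exact: enorm_radial_proj.
Qed.

Lemma sphere_measure_unit_sphere d : (0 < d)%N ->
  sphere_measure R d (unit_sphere R d) = 1.
Proof.
move=> d0; rewrite -[LHS]adde0 -(sphere_measure_unit_sphereC d0).
rewrite -measureU ?setUv ?setICr//; first exact: probability_setT.
- exact: measurable_unit_sphere.
- by apply: measurableC; exact: measurable_unit_sphere.
Qed.

Lemma integral_sphere_measure_cst d (r : R) : (0 < d)%N ->
  \int[sphere_measure R d]_(x in unit_sphere R d) r%:E = r%:E.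
Proof.
move=> d0; transitivity (r%:E * 1); last by rewrite mule1.
rewrite -(sphere_measure_unit_sphere d0).
by apply: (integral_cst (sphere_measure R d)); exact: measurable_unit_sphere.
Qed.

Lemma ge0_integral_sphere_measure d (f : Rvec R d -> \bar R) : (0 < d)%N ->
  measurable_fun setT f -> (forall x, 0 <= f x) ->
  \int[sphere_measure R d]_(x in unit_sphere R d) f x =
  ((fine (cone_measure R d setT))^-1)%:E * \int[cone_measure R d]_x f x.
Proof.
move=> d0 mf f0.
have V0 : (0 <= (fine (cone_measure R d setT))^-1)%R.
  by rewrite invr_ge0 fine_ge0.
transitivity (\int[sphere_measure R d]_x f x).
  rewrite [RHS](@ge0_negligible_integral _ _ _ _ _ (~` unit_sphere R d))//.
  - by rewrite setTD setCK.
  - by apply: measurableC; exact: measurable_unit_sphere.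
  - exact: sphere_measure_unit_sphereC.
rewrite -[RHS](ge0_integral_mscale (cone_measure R d) measurableT (NngNum V0))//.
apply: eq_measure_integral => A mA _.
by rewrite [RHS]muleC; exact: sphere_measureE.
Qed.

Lemma coordinate_hyperplane_null d (i : 'I_d) :
  lebesgue_Rvec R d [set x | (tnth x i : R) = 0%R] = 0.
Proof.
pose A (j : 'I_d) : set (measurableTypeR R) := if j == i then [set 0%R] else setT.
have mA j : measurable (A j) by rewrite /A; case: ifP.
rewrite (_ : mkset _ = [set x | forall j, A j (tnth x j)]).
  rewrite lebesgue_Rvec_box// (bigD1 i)//= {1}/A eqxx.
  by rewrite lebesgue_measure_set1 mul0e.
apply/seteqP; split => x /=; last by move=> /(_ i); rewrite /A eqxx.
by move=> xi j; rewrite /A; case: ifPn => // /eqP ->.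
Qed.

Lemma enorm_eq0 d (x : Rvec R d) i : enorm x = 0%R -> tnth x i = 0%R.
Proof. by move=> x0; rewrite -(vscale_radial_proj x) x0 tnth_vscale mul0r. Qed.

(** If the integral were 0, almost all of the ball would lie in a coordinate
    hyperplane, which is a null set. *)
Lemma integral_projection_gt0 j k e : (0 < k)%N -> (0 < e)%N ->
  0 < \int[sphere_measure R (j + k)]_(x in unit_sphere R (j + k))
        (enorm (vproj (@rshift j k) x) ^+ e)%:E.
Proof.
move=> k0 e0; have jk0 : (0 < j + k)%N by rewrite addn_gt0 k0 orbT.
have V0 := cone_measureT_gt0 R jk0; have V1 := @cone_measureT_lty R (j + k).
have mf : measurable_fun setT (fun x : Rvec R (j + k) =>
    (enorm (vproj (@rshift j k) x) ^+ e)%:E).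
  apply/measurable_EFinP/measurable_funX.
  exact: (measurableT_comp (@measurable_enorm R k) (@measurable_vproj _ _ _ _)).
have f0 (x : Rvec R (j + k)) : 0 <= (enorm (vproj (@rshift j k) x) ^+ e)%:E.
  by rewrite lee_fin exprn_ge0// enorm_ge0.
rewrite ge0_integral_sphere_measure// mule_gt0//.
  by rewrite lte_fin invr_gt0 fine_gt0// V0.
rewrite lt_neqAle integral_ge0// andbT eq_sym; apply/eqP.
rewrite ge0_integral_cone_measure// => I0.
have mfp := measurableT_comp mf (@measurable_radial_proj R (j + k)).
have := (ae_eq_integral_abs (@ball_measure R (j + k)) measurableT mfp).1.
case.
  by rewrite -[RHS]I0; apply: eq_integral => x _; exact: gee0_abs (f0 (radial_proj x)).
move=> N [mN N0 fN].
pose i := rshift j (Ordinal k0).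
have mH : measurable [set x : Rvec R (j + k) | (tnth x i : R) = 0%R].
  rewrite (_ : mkset _ = (fun x : Rvec R (j + k) => (tnth x i : measurableTypeR R)) @^-1` [set 0%R])//.
  by rewrite -[X in measurable X]setTI; exact: measurable_tnth.
have : cone_measure R (j + k) setT <= 0; last by rewrite leNgt V0.
rewrite -ball_measureT.
apply: (@le_trans _ _ (@ball_measure R (j + k) (N `|` [set x | (tnth x i : R) = 0%R]))).
  apply: le_measure; rewrite ?inE//; first exact: measurableU.
  move=> x _; have [x0|/eqP x0] := pselect ((tnth x i : R) = 0%R); [by right|left].
  apply: fN => /= /(_ Logic.I) /(congr1 fine) /= /eqP.
  rewrite expf_eq0 e0/= => /eqP/(@enorm_eq0 _ _ (Ordinal k0)).
  rewrite tnth_vproj tnth_radial_proj => /eqP; rewrite mulf_eq0 (negbTE x0)/= invr_eq0.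
  by move=> /eqP/(@enorm_eq0 _ _ i) /eqP; rewrite (negbTE x0).
apply: le_trans (measureU2 _ mN mH) _.
rewrite [X in X + _]N0 add0e; rewrite /ball_measure /mrestr.
rewrite -(coordinate_hyperplane_null i); apply: le_measure; rewrite ?inE//.
by apply: measurableI => //; exact: measurable_punctured_ball.
Qed.

Let muleBl_pos (c : R) (a b : \bar R) : (0 < c)%R ->
  c%:E * (a - b) = c%:E * a - c%:E * b.
Proof.
move=> c0; have c0' : 0 < c%:E by rewrite lte_fin.
case: a b => [a||] [b||] //=;
  rewrite ?(gt0_muley, gt0_muleNy, addeNy, addNye, addye, addey)//=.
by rewrite -EFinD -EFinM mulrBr EFinD EFinM.
Qed.

(** The shadow of the sphere measure on a coordinate subspace is rotation
    invariant, so on homogeneous functions of a fixed degree only a scalar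
    distinguishes it from the sphere measure of that subspace. *)
Lemma integral_sphere_measure_projection j k e : (0 < k)%N -> (0 < e)%N ->
  exists2 c : R, (0 < c)%R & forall g : Rvec R k -> R,
    measurable_fun setT g -> homogeneous e g ->
    \int[sphere_measure R (j + k)]_(x in unit_sphere R (j + k))
      (g (vproj (@rshift j k) x))%:E =
    c%:E * \int[sphere_measure R k]_(y in unit_sphere R k) (g y)%:E.
Proof.
move=> k0 e0; have jk0 : (0 < j + k)%N by rewrite addn_gt0 k0 orbT.
have [C C0 CE] := @integral_cone_measure_drop j k e k0 e0.
have V0 := cone_measureT_gt0 R k0; have V1 := @cone_measureT_lty R k.
have fV : (0 < fine (cone_measure R k setT))%R by rewrite fine_gt0// V0.
pose c := (fine (cone_measure R (j + k) setT))^-1%:E * C *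
  (fine (cone_measure R k setT))%:E.
have cE (g : Rvec R k -> R) : measurable_fun setT g ->
    (forall x, (0 <= g x)%R) -> homogeneous e g ->
    \int[sphere_measure R (j + k)]_(x in unit_sphere R (j + k))
      (g (vproj (@rshift j k) x))%:E =
    c * \int[sphere_measure R k]_(y in unit_sphere R k) (g y)%:E.
  move=> mg g0 hg; rewrite ge0_integral_sphere_measure//; last 2 first.
  - by apply/measurable_EFinP; exact: (measurableT_comp mg (@measurable_vproj _ _ _ _)).
  - by move=> x; rewrite lee_fin.
  rewrite CE// ge0_integral_sphere_measure//; last exact/measurable_EFinP.
  by rewrite /c muleA -!muleA; do 2 congr (_ * _); rewrite muleA -EFinM divff ?mul1e// gt_eqF.
have m_enorm : measurable_fun setT (fun y : Rvec R k => enorm y ^+ e)%R.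
  by apply: measurable_funX; exact: measurable_enorm.
have enorm0 (y : Rvec R k) : (0 <= enorm y ^+ e)%R by rewrite exprn_ge0// enorm_ge0.
have c_int : c = \int[sphere_measure R (j + k)]_(x in unit_sphere R (j + k))
        (enorm (vproj (@rshift j k) x) ^+ e)%:E.
  rewrite (cE _ m_enorm enorm0 (@homogeneous_enorm _ _ _)).
  rewrite (eq_integral (cst 1%:E)) ?integral_sphere_measure_cst ?mule1//.
  by move=> y /set_mem yS; rewrite (yS : enorm y = 1%R) expr1n.
have c_gt0 : 0 < c by rewrite c_int; exact: integral_projection_gt0.
(* Projection shortens vectors, so the constant is at most 1. *)
have c_lty : c < +oo.
  rewrite c_int; apply: (@le_lt_trans _ _ 1); last exact: ltry.
  rewrite -(integral_sphere_measure_cst 1 jk0).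
  apply: ge0_le_integral => //.
  - exact: measurable_unit_sphere.
  - by move=> x _; rewrite lee_fin enorm0.
  - by apply/measurable_EFinP/measurable_funTS; apply: (measurableT_comp m_enorm); exact: measurable_vproj.
  - move=> x xS; rewrite lee_fin exprn_ile1 ?enorm_ge0//.
    rewrite -(xS : enorm x = 1%R) ler_wsqrtr// big_split_ord/=.
    under eq_bigr do rewrite tnth_vproj.
    by rewrite lerDr sumr_ge0// => i _; exact: sqr_ge0.
have cr : c = (fine c)%:E by rewrite fineK// ge0_fin_numE// ltW.
exists (fine c); first by rewrite fine_gt0// c_gt0.
move=> g mg hg; rewrite -cr integralE [in RHS]integralE cr muleBl_pos -?cr; last by rewrite fine_gt0// c_gt0.
rewrite (_ : (fun y => (g y)%:E) = EFin \o g)// !funerpos !funerneg /=.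
rewrite -(cE (g^\+)%R); last 3 first.
- exact: measurable_funrpos.
- exact: funrpos_ge0.
- by move=> a x a0; rewrite /funrpos/= hg// maxr_pMr ?exprn_ge0// mulr0.
rewrite -(cE (g^\-)%R); last 3 first.
- exact: measurable_funrneg.
- exact: funrneg_ge0.
- by move=> a x a0; rewrite /funrneg/= hg// maxr_pMr ?exprn_ge0// mulr0 mulrN.
by congr (_ - _); apply: eq_integral => x _.
Qed.
End projection_of_the_sphere.

(** * Reflection and even polynomials *)

Section sphere_reflection.
Variable R : realType.
Local Open Scope ereal_scope.

Lemma sphere_measure_reflection d (A : set (Rvec R d)) : (0 < d)%N ->
  measurable A ->
  sphere_measure R d (vscale (-1) @^-1` A) = sphere_measure R d A.
Proof.
move=> d0 mA; rewrite !sphere_measureE//; congr (_ * _).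
rewrite /cone_measure /pushforward /mrestr.
have mproj : measurable (@radial_proj R d @^-1` A).
  by rewrite -[X in measurable X]setTI; exact: measurable_radial_proj.
rewrite [RHS](@lebesgue_Rvec_dilation _ _ (-1)) ?oppr_eq0 ?oner_eq0//; last first.
  by apply: measurableI => //; exact: measurable_punctured_ball.
rewrite normrN1 expr1n mul1e; congr (lebesgue_Rvec R d _).
apply/seteqP; split => x; rewrite /preimage /punctured_ball /= enorm_vscale normrN1 mul1r;
  rewrite !radial_projE enorm_vscale normrN1 mul1r;
  rewrite (_ : vscale _ (vscale _ x) = vscale (-1) (vscale (enorm x)^-1%R x))//;
  by apply: eq_from_tnth => i; rewrite !tnth_vscale mulrCA.
Qed.

Lemma unit_sphere_vscaleN1 d (x : Rvec R d) :
  unit_sphere R d (vscale (-1) x) = unit_sphere R d x.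
Proof. by rewrite /unit_sphere/= enorm_vscale normrN1 mul1r. Qed.

Lemma integral_sphere_measure_reflection d (f : Rvec R d -> \bar R) : (0 < d)%N ->
  measurable_fun setT f ->
  (sphere_measure R d).-integrable (unit_sphere R d) (f \o vscale (-1)) ->
  \int[sphere_measure R d]_(x in unit_sphere R d) f (vscale (-1) x) =
  \int[sphere_measure R d]_(x in unit_sphere R d) f x.
Proof.
move=> d0 mf intf.
have mS := @measurable_unit_sphere R d.
have SE : vscale (-1) @^-1` unit_sphere R d = unit_sphere R d.
  by apply/seteqP; split => x; rewrite /preimage/= unit_sphere_vscaleN1.
rewrite -[in LHS]SE -(integral_pushforward (@measurable_vscale R d (-1)))//; last by rewrite SE.
apply: (@eq_measure_integral _ _ _ _ (sphere_measure R d)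
  (measure_function_pushforward__canonical__measure_function_Measure
    (sphere_measure R d) (@measurable_vscale R d (-1)))) => A mA _.
exact: sphere_measure_reflection.
Qed.

End sphere_reflection.

Section polynomials_on_the_sphere.
Variable R : realType.

Lemma norm_tnth_unit_sphere d (x : Rvec R d) i :
  unit_sphere R d x -> `|tnth x i : R| <= 1.
Proof.
move=> xS; rewrite -(xS : enorm x = 1) -sqrtr_sqr ler_wsqrtr//.
by rewrite (bigD1 i)//= lerDl sumr_ge0// => j _; exact: sqr_ge0.
Qed.

Lemma measurable_meval d (f : mpoly d R) :
  measurable_fun setT (fun x : Rvec R d => meval (tnth x) f : R).
Proof.
under eq_fun do rewrite mevalE.
apply: measurable_sum => m; apply: measurable_funM; first exact: measurable_cst.
apply: measurable_prod => i _; apply: measurable_funX; exact: measurable_tnth.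
Qed.

Lemma integrable_sphere_bounded d (f : Rvec R d -> R) (M : R) :
  measurable_fun setT f -> (forall x, unit_sphere R d x -> `|f x| <= M) ->
  (sphere_measure R d).-integrable (unit_sphere R d) (EFin \o f).
Proof.
move=> mf fM; apply: measurable_bounded_integrable.
- exact: measurable_unit_sphere.
- apply: le_lt_trans (probability_le1 _ _) (ltry 1); exact: measurable_unit_sphere.
- exact: measurable_funTS.
by exists M; split => [|K MK x /fM/le_trans]; [exact: num_real|apply; exact: ltW].
Qed.

Lemma meval_bounded_unit_sphere d (f : mpoly d R) (x : Rvec R d) :
  unit_sphere R d x -> `|meval (tnth x) f| <= \sum_(m <- msupp f) `|mcoeff m f|.
Proof.
move=> xS; rewrite mevalE.
apply: le_trans (ler_norm_sum _ _ _) _; apply: ler_sum => m _.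
rewrite normrM ler_piMr// normr_prod; apply: prodr_ile1 => i _.
by rewrite normr_ge0 normrX exprn_ile1// norm_tnth_unit_sphere.
Qed.

Lemma integrable_meval d (f : mpoly d R) :
  (sphere_measure R d).-integrable (unit_sphere R d)
    (fun x : Rvec R d => (meval (tnth x) f)%:E).
Proof.
apply: integrable_sphere_bounded (@meval_bounded_unit_sphere d f).
exact: measurable_meval.
Qed.

(** On the unit sphere this is the even part of [f]; the powers of the squared
    norm, which is 1 there, bring its monomials to the same degree [e] when [e]
    is even and bounds their degrees. *)
Definition even_homogenization d e (f : mpoly d R) (x : Rvec R d) : R :=
  \sum_(m <- msupp f | ~~ odd (mdeg m))
    mcoeff m f * (\prod_(i < d) (tnth x i : R) ^+ m i *
                  (\sum_(i < d) (tnth x i : R) ^+ 2) ^+ (e - mdeg m)./2).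

(** The pullback of [even_homogenization] along [vproj phi], as a polynomial: a
    design in dimension [d] can only be tested on polynomials. *)
Definition even_homogenization_mpoly k d (phi : 'I_k -> 'I_d) e (f : mpoly k R) :
    mpoly d R :=
  \sum_(m <- msupp f | ~~ odd (mdeg m))
    mcoeff m f *: (\prod_(i < k) mpolyX R (mnm1 (phi i)) ^+ m i *
                  (\sum_(i < k) mpolyX R (mnm1 (phi i)) ^+ 2) ^+ (e - mdeg m)./2).

Let mevalXn d (v : 'I_d -> R) (p : mpoly d R) n :
  meval v (p ^+ n) = meval v p ^+ n.
Proof. exact: rmorphXn. Qed.

Lemma meval_even_homogenization k d (phi : 'I_k -> 'I_d) e (f : mpoly k R)
    (x : Rvec R d) :
  meval (tnth x) (even_homogenization_mpoly phi e f) =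
  even_homogenization e f (vproj phi x).
Proof.
rewrite raddf_sum /even_homogenization; apply: eq_bigr => m _.
rewrite /= mevalZ mevalM rmorph_prod rmorphXn raddf_sum; congr (_ * (_ * _ ^+ _)).
  by apply: eq_bigr => i _; rewrite /= mevalXn mevalXU tnth_vproj.
by apply: eq_bigr => i _; rewrite /= mevalXn mevalXU tnth_vproj.
Qed.

Lemma measurable_even_homogenization d e (f : mpoly d R) :
  measurable_fun setT (even_homogenization e f : Rvec R d -> R).
Proof.
apply: eq_measurable_fun (measurable_meval (even_homogenization_mpoly id e f)).
by move=> x _; rewrite meval_even_homogenization vproj_id.
Qed.

Let msizeM_leq d (p q : mpoly d R) a b :
  (msize p <= a.+1)%N -> (msize q <= b.+1)%N -> (msize (p * q) <= (a + b).+1)%N.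
Proof.
have [->|p0] := eqVneq p 0; first by rewrite mul0r msize0.
have [->|q0] := eqVneq q 0; first by rewrite mulr0 msize0.
move=> pa qb; rewrite msizeM//.
by have := leq_add pa qb; rewrite addSn addnS; case: (msize p + msize q)%N.
Qed.

Let msizeX_leq d (p : mpoly d R) a n :
  (msize p <= a.+1)%N -> (msize (p ^+ n) <= (a * n).+1)%N.
Proof.
move=> pa; elim: n => [|n IH]; first by rewrite expr0 msize1.
by rewrite exprS mulnS; exact: msizeM_leq.
Qed.

Let msize_prod_leq d (I : Type) (r : seq I) (F : I -> mpoly d R) (a : I -> nat) :
  (forall i, (msize (F i) <= (a i).+1)%N) ->
  (msize (\prod_(i <- r) F i) <= (\sum_(i <- r) a i).+1)%N.
Proof.
move=> Fa; elim: r => [|i r IH]; first by rewrite !big_nil msize1.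
by rewrite !big_cons; exact: msizeM_leq.
Qed.

Let msize_sum_leq d (I : eqType) (r : seq I) (P : pred I) (F : I -> mpoly d R) a :
  (forall i, i \in r -> P i -> (msize (F i) <= a)%N) ->
  (msize (\sum_(i <- r | P i) F i) <= a)%N.
Proof.
move=> Fa; apply: leq_trans (msize_sum _ _ _) _.
rewrite big_seq_cond; apply/bigmax_leqP_seq => i _ /andP[ir Pi]; exact: Fa.
Qed.

(** [t./2.*2] is the largest even number up to [t], so an even degree up to [t]
    falls short of it by an even number. *)
Let mdeg_even d t (f : mpoly d R) m : (msize f <= t.+1)%N ->
  m \in msupp f -> ~~ odd (mdeg m) -> (mdeg m + (t./2.*2 - mdeg m)./2.*2 = t./2.*2)%N.
Proof. by move=> ft /msize_mdeg_lt mf; lia. Qed.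

Lemma msize_even_homogenization k d (phi : 'I_k -> 'I_d) t (f : mpoly k R) :
  (msize f <= t.+1)%N ->
  (msize (even_homogenization_mpoly phi t./2.*2 f) <= t.+1)%N.
Proof.
move=> ft; apply: msize_sum_leq => m mf em.
apply: leq_trans (msizeZ_le _ _) _.
have msizeU i : (msize (mpolyX R (mnm1 (phi i))) <= 2)%N by rewrite msizeX mdeg1.
apply: (@leq_trans (mdeg m + 2 * (t./2.*2 - mdeg m)./2).+1); last first.
  by rewrite mul2n (mdeg_even ft mf em); lia.
apply: msizeM_leq.
  rewrite mdegE; apply: msize_prod_leq => i; rewrite -{2}[m i]mul1n.
  exact: msizeX_leq.
apply: msizeX_leq; apply: msize_sum_leq => i _ _.
exact: (@msizeX_leq _ _ 1 2).
Qed.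

Lemma homogeneous_even_homogenization d t (f : mpoly d R) :
  (msize f <= t.+1)%N -> homogeneous t./2.*2 (even_homogenization t./2.*2 f).
Proof.
move=> ft a x _; rewrite /even_homogenization mulr_sumr.
rewrite big_seq_cond [RHS]big_seq_cond; apply: eq_bigr => m /andP[mf em].
have -> : \sum_(i < d) (tnth (vscale a x) i : R) ^+ 2 =
    a ^+ 2 * \sum_(i < d) (tnth x i : R) ^+ 2.
  by rewrite mulr_sumr; apply: eq_bigr => i _; rewrite tnth_vscale exprMn.
under eq_bigr do rewrite tnth_vscale exprMn.
rewrite big_split/= -expr_sum -mdegE exprMn -exprM mul2n.
by rewrite -{3}(mdeg_even ft mf em) exprD; ring.
Qed.

Lemma even_homogenization_unit_sphere d e (f : mpoly d R) (x : Rvec R d) :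
  unit_sphere R d x ->
  meval (tnth x) f + meval (tnth (vscale (-1) x)) f =
  even_homogenization e f x + even_homogenization e f x.
Proof.
move=> xS; rewrite !mevalE /even_homogenization -sqr_enorm (xS : enorm x = 1) expr1n.
rewrite [in RHS]big_mkcond -!big_split/=; apply: eq_bigr => m _.
under [X in _ + _ * X]eq_bigr do rewrite tnth_vscale exprMn.
rewrite big_split/= -expr_sum -mdegE -signr_odd expr1n mulr1.
by case: (odd _); rewrite /= ?expr0 ?expr1 ?mul1r// mulN1r mulrN subrr addr0.
Qed.

(** With no positive even degree available only the constant term survives. *)
Lemma even_homogenization_cst d (f : mpoly d R) (x y : Rvec R d) :
  (msize f <= 2)%N -> even_homogenization 0 f x = even_homogenization 0 f y.
Proof.
move=> f2; rewrite /even_homogenization big_seq_cond [RHS]big_seq_cond.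
apply: eq_bigr => m /andP[/msize_mdeg_lt mf em].
have m0 : mdeg m = 0%N by lia.
by rewrite sub0n !expr0; move/eqP: m0; rewrite mdeg_eq0 => /eqP ->;
  rewrite !big1// => i _; rewrite mnm0E expr0.
Qed.

(** Averaging [f] with its reflection does not change its integral and leaves
    its even part. *)
Lemma integral_even_homogenization d e (f : mpoly d R) : (0 < d)%N ->
  (\int[sphere_measure R d]_(x in unit_sphere R d) (meval (tnth x) f)%:E =
  \int[sphere_measure R d]_(x in unit_sphere R d) (even_homogenization e f x)%:E)%E.
Proof.
move=> d0; have mS := @measurable_unit_sphere R d.
have intf := integrable_meval f.
have intH : (sphere_measure R d).-integrable (unit_sphere R d)
    (fun x => (even_homogenization e f x)%:E).
  have := integrable_meval (even_homogenization_mpoly id e f).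
  by apply: eq_integrable => // x _; rewrite meval_even_homogenization vproj_id.
have mf : measurable_fun setT (fun x : Rvec R d => (meval (tnth x) f)%:E).
  by apply/measurable_EFinP; exact: measurable_meval.
have intfN : (sphere_measure R d).-integrable (unit_sphere R d)
    ((fun x : Rvec R d => (meval (tnth x) f)%:E) \o vscale (-1)).
  apply: (@integrable_sphere_bounded _ (fun x => meval (tnth (vscale (-1) x)) f)
    (\sum_(m <- msupp f) `|mcoeff m f|)).
    exact: (measurableT_comp (@measurable_meval d f) (@measurable_vscale R d (-1))).
  by move=> x xS; apply: meval_bounded_unit_sphere; rewrite unit_sphere_vscaleN1.
have := integral_sphere_measure_reflection d0 mf intfN.
have := integrable_fin_num mS intf; have := integrable_fin_num mS intH.
move=> fH ff fN.
have : (\int[sphere_measure R d]_(x in unit_sphere R d) (meval (tnth x) f)%:E +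
    \int[sphere_measure R d]_(x in unit_sphere R d) (meval (tnth x) f)%:E =
  \int[sphere_measure R d]_(x in unit_sphere R d) (even_homogenization e f x)%:E +
  \int[sphere_measure R d]_(x in unit_sphere R d) (even_homogenization e f x)%:E)%E.
  rewrite -{2}fN -!integralD//; apply: eq_integral => x /set_mem xS /=.
  by rewrite -!EFinD (even_homogenization_unit_sphere e f xS).
rewrite -(fineK ff) -(fineK fH) -!EFinD => -[] H; congr EFin.
by lra.
Qed.

End polynomials_on_the_sphere.

(** * Construction of designs *)

Section designs.
Variable R : realType.

(** Points of the family that coincide are merged and their weights added, which
    is why the number of points is only bounded. *)
Lemma design_of_family t k (I : finType) (P : pred I) (z : I -> Rvec R k)
    (u : I -> R) :
  (forall i, P i -> unit_sphere R k (z i)) -> (forall i, P i -> 0 < u i) ->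
  (forall f : mpoly k R, (msize f <= t.+1)%N ->
    (\sum_(i | P i) u i * meval (tnth (z i)) f)%:E =
    (\int[sphere_measure R k]_(x in unit_sphere R k) (meval (tnth x) f)%:E)%E) ->
  exists (Y : {fset Rvec R k}) (v : Y -> R),
    weighted_spherical_design t Y v /\ (#|` Y| <= #|P|)%N.
Proof.
move=> zS u0 zf.
pose Y : {fset Rvec R k} := [fset z i | i in P]%fset.
pose v (y : Y) : R := \sum_(i | P i && (z i == val y)) u i.
exists Y, v; split; last by apply: leq_trans (leq_imfset_card _ _ _) _; rewrite /= -cardE.
have YP (y : Y) : exists2 i, P i & val y = z i.
  by case/imfsetP: (valP y) => i /= Pi ->; exists i.
split.
- by move=> y; have [i Pi ->] := YP y; exact: zS.
- move=> y; have [i Pi yi] := YP y; rewrite /v (bigD1 i)/=; last first.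
    by rewrite Pi yi eqxx.
  rewrite ltr_pwDl ?u0// sumr_ge0// => j /andP[/andP[Pj _] _].
  by rewrite ltW// u0.
move=> f ft; rewrite -zf//; congr EFin.
under eq_bigr do rewrite /v mulr_suml.
rewrite (exchange_big_dep P)/=; last by move=> y i _ /andP[].
apply: eq_bigr => i Pi.
have Yi : z i \in Y by apply/imfsetP; exists i.
rewrite (big_pred1 [` Yi]%fset)//= => y; rewrite Pi/= eq_sym.
by rewrite -val_eqE.
Qed.

(** Symmetrizing by the antipodal map takes care of the odd part of a
    polynomial, on both sides. *)
Lemma antipodal_design_of_family t k (I : finType) (P : pred I)
    (z : I -> Rvec R k) (u : I -> R) : (0 < k)%N ->
  (forall i, P i -> unit_sphere R k (z i)) -> (forall i, P i -> 0 < u i) ->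
  (forall f : mpoly k R, (msize f <= t.+1)%N ->
    (\sum_(i | P i) u i * even_homogenization t./2.*2 f (z i))%:E =
    (\int[sphere_measure R k]_(x in unit_sphere R k)
       (even_homogenization t./2.*2 f x)%:E)%E) ->
  exists (Y : {fset Rvec R k}) (v : Y -> R),
    weighted_spherical_design t Y v /\ (#|` Y| <= 2 * #|P|)%N.
Proof.
move=> k0 zS u0 zf.
pose P' (p : I * bool) := P p.1.
pose z' (p : I * bool) : Rvec R k := if p.2 then z p.1 else vscale (-1) (z p.1).
have [|||Y [v [Yv cY]]] := @design_of_family t k _ P' z' (fun p => u p.1 / 2).
- move=> [i []] Pi; rewrite /z' /= ?unit_sphere_vscaleN1; exact: zS.
- by move=> [i b] /= Pi; rewrite divr_gt0// u0.
- move=> f ft; rewrite (integral_even_homogenization t./2.*2 f)// -zf//; congr EFin.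
  rewrite (eq_bigl (fun p : I * bool => P p.1 && xpredT p.2)); last by move=> p; rewrite andbT.
  rewrite -(pair_big P xpredT (fun i b => u i / 2 * meval (tnth (z' (i, b))) f))/=.
  apply: eq_bigr => i Pi; rewrite big_bool /z' /= -mulrDr.
  rewrite (even_homogenization_unit_sphere t./2.*2 f (zS i Pi)).
  by field.
exists Y, v; split => //; apply: leq_trans cY _.
rewrite (_ : #|P'| = #|[predX P & {: bool}]|); first by rewrite cardX card_bool mulnC.
by apply: eq_card => -[i b]; rewrite !inE andbT.
Qed.

Lemma unit_basis_vector k : (0 < k)%N -> exists x : Rvec R k, unit_sphere R k x.
Proof.
move=> k0; exists [tuple (if i == Ordinal k0 then 1 else 0)%R | i < k].
rewrite /unit_sphere/= /enorm (bigD1 (Ordinal k0))//= tnth_mktuple eqxx expr1n.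
rewrite big1 ?addr0 ?sqrtr1// => i /negbTE i0.
by rewrite tnth_mktuple i0 expr0n.
Qed.

(** The even part of a polynomial of degree at most 1 is constant, so a single
    point integrates it. *)
Lemma antipodal_pair_design k : (0 < k)%N ->
  exists (Y : {fset Rvec R k}) (v : Y -> R),
    weighted_spherical_design 1 Y v /\ (#|` Y| <= 2)%N.
Proof.
move=> k0; have [x xS] := unit_basis_vector k0.
have [|||Y [v [Yv cY]]] := @antipodal_design_of_family 1 k unit xpredT
  (fun=> x) (fun=> 1) k0; [by []|by []| |].
- move=> f f2; rewrite (big_pred1 tt); last by case.
  rewrite mul1r -[LHS](integral_sphere_measure_cst _ k0).
  by apply: eq_integral => y _; congr EFin; exact: even_homogenization_cst.
- by exists Y, v; split => //; apply: leq_trans cY _; rewrite card_unit.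
Qed.

(** Projecting and rescaling the points: on homogeneous polynomials of degree
    [e], the weight [w x * |P x| ^ e] at [P x / |P x|] does what the weight
    [w x] does at [P x]. *)
Lemma projected_design t j k (X : {fset Rvec R (j + k)}) (w : X -> R) :
  (0 < k)%N -> (1 < t)%N -> weighted_spherical_design t X w ->
  exists (Y : {fset Rvec R k}) (v : Y -> R),
    weighted_spherical_design t Y v /\ (#|` Y| <= 2 * #|` X|)%N.
Proof.
move=> k0 t1 [XS w0 wf].
have e0 : (0 < t./2.*2)%N by lia.
have [c c0 cE] := integral_sphere_measure_projection R j k0 e0.
pose p (x : X) := vproj (@rshift j k) (val x).
have [|||Y [v [Yv cY]]] := @antipodal_design_of_family t k X
  (fun x => enorm (p x) != 0) (fun x => radial_proj (p x))
  (fun x => w x * enorm (p x) ^+ t./2.*2 / c) k0.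
- by move=> x px0; apply: enorm_radial_proj; rewrite lt_neqAle eq_sym px0 enorm_ge0.
- move=> x px0; rewrite divr_gt0// mulr_gt0// exprn_gt0//.
  by rewrite lt_neqAle eq_sym px0 enorm_ge0.
- move=> f ft.
  have hf := homogeneous_even_homogenization ft.
  have := wf _ (msize_even_homogenization (@rshift j k) ft).
  under eq_bigr do rewrite meval_even_homogenization.
  under eq_integral do rewrite meval_even_homogenization.
  rewrite cE//; last exact: measurable_even_homogenization.
  move=> /(congr1 (fun r => (c^-1)%:E * r)%E).
  rewrite muleA -!EFinM mulVf ?gt_eqF// mul1e => <-; congr EFin.
  rewrite mulr_sumr big_mkcond/=; apply: eq_bigr => x _.
  rewrite [in RHS](homogeneousE _ hf) -/(p x); case: ifPn => [_|].
    by rewrite [RHS]mulrC !mulrA mulrAC.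
  by rewrite negbK => /eqP ->; rewrite expr0n gtn_eqF// !(mul0r, mulr0).
exists Y, v; split => //; apply: leq_trans cY _.
by rewrite leq_mul2l/= cardfE max_card.
Qed.

End designs.

Local Open Scope fset_scope.

Theorem corollary3p5 (R : realType) (t d k N : nat)
    (ht : (0 < t)%N) (hd : (0 < d)%N) (hk : (0 < k)%N) (hN : (0 < N)%N)
    (hkd : (k <= d)%N) :
  (exists (X : {fset Rvec R d}) (w : X -> R),
     weighted_spherical_design t X w /\ #|` X| = N) ->
  exists (Y : {fset Rvec R k}) (v : Y -> R),
    weighted_spherical_design t Y v /\ (#|` Y| <= 2 * (t + 1) * N)%N.
Proof.
have [j dE] : exists j, d = (j + k)%N by exists (d - k)%N; rewrite subnK.
subst d; move=> [X [w [Xw XN]]].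
have [t1|] := ltnP 1 t.
  have [Y [v [Yv cY]]] := projected_design hk t1 Xw.
  exists Y, v; split => //; apply: leq_trans cY _.
  by rewrite XN -mulnA leq_mul2l leq_pmull// addn1.
rewrite leq_eqVlt ltnS leqNgt ht orbF => /eqP t1; subst t.
have [Y [v [Yv cY]]] := antipodal_pair_design R hk.
by exists Y, v; split => //; apply: leq_trans cY _; lia.
Qed.
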